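(* Let $G$ be a graph of order $n$ and let $\rho(A_{Lz}(G))$ be the Lanzhou spectral radius of $G$. Then the Lanzhou energy satisfies $$\mathcal{E}_{Lz}(G)\leq n\,\rho(A_{Lz}(G)).$$
   Context: Graphs are finite, simple and undirected. For a graph $G$ on $n$ vertices, $d_G(u)$ is the degree of $u$ in $G$ and $d_{\overline{G}}(u)=n-1-d_G(u)$ is its degree in the complement $\overline{G}$. The Lanzhou matrix $A_{Lz}(G)$ is the real symmetric $n\times n$ matrix indexed by vertices whose $(u,v)$ entry is $d_G(u)d_{\overline{G}}(u)+d_G(v)d_{\overline{G}}(v)$ if $u$ and $v$ are adjacent in $G$, and $0$ otherwise. If its eigenvalues are $\lambda_1\geq\cdots\geq\lambda_n$ (with multiplicity), the Lanzhou energy is $\mathcal{E}_{Lz}(G)=\sum_{i=1}^n|\lambda_i|$, and the Lanzhou spectral radius $\rho(A_{Lz}(G))$ is the largest eigenvalue $\lambda_1$ of $A_{Lz}(G)$. *)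

(* Defs.v *)
(* [R : rcfType] is an arbitrary real closed field; the intended instance is the
   field of real numbers. *)
From mathcomp Require Import all_boot all_order all_algebra.
From mathcomp Require Import complex polyrcf.

Set Implicit Arguments.
Unset Strict Implicit.
Unset Printing Implicit Defensive.

Import Order.TTheory GRing.Theory Num.Theory.
Local Open Scope ring_scope.

Definition simple_graph (T : finType) (e : rel T) : Prop :=
  symmetric e /\ irreflexive e.

Definition compl_graph (T : finType) (e : rel T) : rel T :=
  fun u v => (u != v) && ~~ e u v.

Definition degree (T : finType) (e : rel T) (u : T) : nat := #|[set v | e u v]|.

Lemma degree_compl (T : finType) (e : rel T) (u : T) : irreflexive e ->
  degree (compl_graph e) u = (#|T| - 1 - degree e u)%N.
Proof.
move=> eI; rewrite /degree /compl_graph.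
have -> : [set v | (u != v) && ~~ e u v] = ~: (u |: [set v | e u v]).
  by apply/setP => v; rewrite !inE negb_or eq_sym.
by rewrite cardsCs setCK cardsU1 inE eI subnDA.
Qed.

Definition lanzhou_weight (T : finType) (e : rel T) (u : T) : nat :=
  (degree e u * degree (compl_graph e) u)%N.

(* The vertex set is identified with ['I_#|T|] through [enum_val]. *)
Definition lanzhou_mx (R : rcfType) (T : finType) (e : rel T) : 'M[R]_#|T| :=
  \matrix_(i, j)
    if e (enum_val i) (enum_val j)
    then (lanzhou_weight e (enum_val i) + lanzhou_weight e (enum_val j))%:R
    else 0.

(* The roots in [R] of the characteristic polynomial, repeated according to
   their multiplicity and listed in decreasing order.  For a symmetric matrix
   these are all the eigenvalues: see [char_poly_eigenvals]. *)
Definition eigenvals (R : rcfType) (n : nat) (A : 'M[R]_n) : seq R :=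
  let p := char_poly A in
  sort >=%R (flatten [seq nseq (mup x p) x | x <- rootsR p]).

Definition energy (R : rcfType) (n : nat) (A : 'M[R]_n) : R :=
  \sum_(x <- eigenvals A) `|x|.

(* Zero, by convention, for the empty matrix. *)
Definition largest_eigenval (R : rcfType) (n : nat) (A : 'M[R]_n) : R :=
  (eigenvals A)`_0.

Definition lanzhou_energy (R : rcfType) (T : finType) (e : rel T) : R :=
  energy (lanzhou_mx R e).

Definition lanzhou_radius (R : rcfType) (T : finType) (e : rel T) : R :=
  largest_eigenval (lanzhou_mx R e).

Lemma lanzhou_mx_sym (R : rcfType) (T : finType) (e : rel T) :
  symmetric e -> (lanzhou_mx R e)^T = lanzhou_mx R e.
Proof. by move=> eC; apply/matrixP => i j; rewrite !mxE eC addnC. Qed.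

Lemma sorted_eigenvals (R : rcfType) (n : nat) (A : 'M[R]_n) :
  sorted >=%R (eigenvals A).
Proof. by apply: sort_sorted => x y; apply: le_total. Qed.

Lemma sym_char_poly_split (R : rcfType) (n : nat) (A : 'M[R]_n) : A^T = A ->
  exists s : seq R, char_poly A = \prod_(x <- s) ('X - x%:P).
Proof.
move=> symA; pose B := map_mx (real_complex R) A.
have hermB : B \is hermsymmx.
  apply/is_hermitianmxP; rewrite expr0 scale1r; apply/matrixP => i j.
  by rewrite !mxE -[in RHS]symA mxE conj_Creal // complex_real.
have := hermitian_spectral_diag_real hermB.
have /hermitian_normalmx/orthomx_spectralP := hermB.
set P := spectralmx B; set d := spectral_diag B => BE dR.
have Pu : P \in unitmx by apply: spectral_unit.
exists [seq complex.Re (d 0 i) | i <- enum 'I_n].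
apply: (map_poly_inj (real_complex R)); rewrite map_char_poly -/B.
have -> : char_poly B = char_poly (diag_mx d).
  rewrite /char_poly.
  have -> : char_poly_mx B =
      map_mx polyC (invmx P) *m char_poly_mx (diag_mx d) *m map_mx polyC P.
    rewrite /char_poly_mx mulmxBr mulmxBl -!map_mxM -BE; congr (_ - _).
    by rewrite -mulmxA -scalar_mxC mulmxA -map_mxM mulVmx // map_mx1 mul1mx.
  rewrite !det_mulmx mulrAC -det_mulmx -map_mxM mulVmx //.
  by rewrite map_mx1 det1 mul1r.
rewrite char_poly_trig ?diag_mx_is_trig // big_map rmorph_prod big_enum /=.
apply: eq_bigr => i _; rewrite mxE eqxx mulr1n rmorphB /= map_polyX map_polyC /=.
by congr (_ - _%:P); apply/esym/RRe_real/mxOverP.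
Qed.

Lemma char_poly_eigenvals (R : rcfType) (n : nat) (A : 'M[R]_n) : A^T = A ->
  char_poly A = \prod_(x <- eigenvals A) ('X - x%:P).
Proof.
move=> /sym_char_poly_split[s ps].
have p0 : char_poly A != 0 by rewrite monic_neq0 ?char_poly_monic.
rewrite [LHS]ps; apply: perm_big; rewrite perm_sym /eigenvals perm_sort.
apply/allP => x _ /=; apply/eqP.
rewrite -[RHS]mu_prod_XsubC -ps count_flatten -map_comp sumnE big_map.
transitivity (\sum_(y <- rootsR (char_poly A) | y == x) mup y (char_poly A))%N.
  rewrite [RHS]big_mkcond; apply: eq_bigr => y _ /=.
  by rewrite count_nseq /=; case: eqP => _; rewrite ?mul1n ?mul0n.
case: (boolP (x \in rootsR (char_poly A))) => [xr | xnr].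
  by rewrite -big_filter filter_pred1_uniq ?big_seq1 ?uniq_roots.
rewrite big_seq_cond big1 => [|y /andP[yr /eqP yx]]; last by rewrite -yx yr in xnr.
rewrite mupNroot //; apply: contra xnr => xr.
by rewrite -(roots_on_rootsR p0) xr.
Qed.

Lemma size_eigenvals (R : rcfType) (n : nat) (A : 'M[R]_n) : A^T = A ->
  size (eigenvals A) = n.
Proof.
move=> /char_poly_eigenvals /(congr1 (fun p : {poly R} => size p)).
by rewrite size_char_poly size_prod_XsubC => -[].
Qed.

(* Main.v *)
(* The largest eigenvalue [r] of a symmetric matrix [A] bounds its Rayleigh
   quotients.  If the entries of [A] are nonnegative and [v] is an eigenvector
   for [a], the triangle inequality gives
   [|a| |v|^2 = |<Av, v>| <= <A|v|, |v|> <= r |v|^2], so every term of the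
   energy is at most [r]. *)
Require Import Defs.
From mathcomp Require Import all_boot all_order all_algebra.
From mathcomp Require Import complex.

Import Order.TTheory GRing.Theory Num.Theory.

Local Open Scope ring_scope.
Local Open Scope sesquilinear_scope.

(** Unitary diagonalization turns the form into a sum of terms [d 0 i] times the squared modulus of
    a coordinate of [w], and every [d 0 i] is an eigenvalue of [B]. *)
Lemma normalmx_rayleigh_le (C : numClosedFieldType) (n : nat) (B : 'M[C]_n)
    (r : C) (w : 'rV[C]_n) :
  B \is normalmx -> (forall a, eigenvalue B a -> a <= r) ->
  (w *m B *m w ^t*) 0 0 <= r * (w *m w ^t*) 0 0.
Proof.
move=> /orthomx_spectralP; set P := spectralmx B; set d := spectral_diag B.
have Pu : P \is unitarymx by apply: spectral_unitarymx.
rewrite invmx_unitary // => BE le_r.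
have d_le i : d 0 i <= r.
  (* Row [i] of the unitary [P] is a left eigenvector for [d 0 i]; it is nonzero because its norm is
     1. *)
  apply/le_r/eigenvalueP; exists (row i P).
    rewrite [B in LHS]BE -row_mul !mulmxA (unitarymxP _) // mul1mx row_mul.
    by rewrite row_diag_mx -scalemxAl -rowE.
  apply/eqP => Pi0; have /row_unitarymxP/(_ i i) := Pu.
  by rewrite Pi0 dotmxE mul0mx mxE eqxx => /esym/eqP; rewrite oner_eq0.
have normE : w *m w ^t* = (w *m P ^t*) *m (w *m P ^t*) ^t*.
  by rewrite trmx_mul map_mxM trmxCK mulmxA mulmxKtV.
have formE : w *m B *m w ^t* = (w *m P ^t*) *m diag_mx d *m (w *m P ^t*) ^t*.
  by rewrite [B in LHS]BE trmx_mul map_mxM trmxCK !mulmxA.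
rewrite normE formE; move: (w *m P ^t*) => y.
rewrite mul_mx_diag !mxE mulr_sumr; apply: ler_sum => i _; rewrite !mxE.
by rewrite [y 0 i * _]mulrC -mulrA ler_wpM2r // mul_conjC_ge0.
Qed.

(** Over [R[i]] the matrix becomes normal. As [char_poly A] already splits over [R], no new
    eigenvalues appear there, so the bound [r] carries over. *)
Lemma sym_rayleigh_le (R : rcfType) (n : nat) (A : 'M[R]_n) (r : R)
    (w : 'rV[R]_n) :
  A^T = A -> (forall x, x \in eigenvals A -> x <= r) ->
  (w *m A *m w^T) 0 0 <= r * (w *m w^T) 0 0.
Proof.
move=> symA le_r; pose f := real_complex R; pose B := map_mx f A.
have conj_map m (M : 'M[R]_(m, n)) : (map_mx f M) ^t* = map_mx f M^T.
  by apply/matrixP => i j; rewrite !mxE conj_Creal // complex_real.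
have normB : B \is normalmx by apply/normalmxP; rewrite conj_map symA.
have eig_le a : eigenvalue B a -> a <= f r.
  rewrite eigenvalue_root_char -map_char_poly char_poly_eigenvals // rmorph_prod.
  under eq_bigr => x _ do rewrite rmorphB /= map_polyX map_polyC /=.
  rewrite -(big_map f xpredT (fun z => 'X - z%:P)) root_prod_XsubC.
  by case/mapP=> x xA ->; rewrite /f lecR le_r.
have := normalmx_rayleigh_le _ _ B (f r) (map_mx f w) normB eig_le.
by rewrite conj_map -!map_mxM !mxE -rmorphM /f lecR.
Qed.

Lemma norm_eigenval_le_largest (R : rcfType) (n : nat) (A : 'M[R]_n) (x : R) :
  A^T = A -> (forall i j, 0 <= A i j) -> x \in eigenvals A ->
  `|x| <= largest_eigenval A.
Proof.
move=> symA A_ge0 xA; set r := largest_eigenval A.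
have le_r y : y \in eigenvals A -> y <= r.
  rewrite /r /largest_eigenval; have := sorted_eigenvals A.
  case: (eigenvals A) => //= z s /(order_path_min ge_trans)/allP zs.
  by rewrite inE => /predU1P[->|/zs].
have /eigenvalueP[v vA v0] : eigenvalue A x.
  by rewrite eigenvalue_root_char char_poly_eigenvals // root_prod_XsubC.
pose w : 'rV[R]_n := map_mx Num.norm v.
have wwE : (w *m w^T) 0 0 = (v *m v^T) 0 0.
  by rewrite !mxE; apply: eq_bigr => i _; rewrite !mxE -normrM ger0_norm ?sqr_ge0.
have vv_gt0 : 0 < (v *m v^T) 0 0.
  have vv_ge0 i : 0 <= v 0 i * v^T i 0 by rewrite mxE -expr2 sqr_ge0.
  rewrite mxE lt_def sumr_ge0 // andbT; apply: contraNneq v0 => vv0.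
  apply/eqP/rowP => i; rewrite mxE; apply/eqP; rewrite -sqrf_eq0 expr2.
  by have /(_ i isT) := psumr_eq0P (fun j _ => vv_ge0 j) vv0; rewrite mxE => ->.
(* Only the right-hand squared norm is rewritten in terms of [w], so that the Rayleigh bound applies
   to [w] while the left side keeps [v]. *)
rewrite -(ler_pM2r vv_gt0) -{2}wwE.
apply: le_trans (sym_rayleigh_le _ _ _ _ w symA le_r).
rewrite -[X in _ * X]gtr0_norm // -normrM.
have -> : x * (v *m v^T) 0 0 = (v *m A *m v^T) 0 0.
  by rewrite vA -scalemxAl [RHS]mxE.
rewrite !mxE; apply: le_trans (ler_norm_sum _ _ _) _; apply: ler_sum => j _.
rewrite normrM !mxE ler_wpM2r //; apply: le_trans (ler_norm_sum _ _ _) _.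
by apply: ler_sum => i _; rewrite normrM mxE (ger0_norm (A_ge0 _ _)).
Qed.

Theorem theorem29 (R : rcfType) (n : nat) (T : finType) (e : rel T)
    (graph_e : simple_graph e) (order_n : #|T| = n) :
  lanzhou_energy R e <= n%:R * lanzhou_radius R e.
Proof.
case: graph_e => symE _.
have symA := lanzhou_mx_sym R symE.
(* Writing [n] as the number of eigenvalues makes the right side a constant sum over the same list,
   to be compared term by term. *)
rewrite /lanzhou_energy /energy mulr_natl -order_n -[X in _ *+ X](size_eigenvals symA).
rewrite -iter_addr_0 -count_predT -big_const_seq big_seq [leRHS]big_seq.
apply: ler_sum => x xA; apply: norm_eigenval_le_largest => // i j.
by rewrite mxE; case: ifP => _ //; rewrite ler0n.
Qed.
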